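(* Let $(L,[\cdot,\cdot],\delta)$ be an InvDer-Lie algebra over $\mathbb{K}$, and let $R:L\to L$ be a Rota-Baxter operator of weight $0$ on $(L,[\cdot,\cdot])$ such that $\delta\circ R=R\circ\delta$ and $\delta^{-1}\circ R=R\circ\delta^{-1}$. Then $(L,\ast,\delta)$ is an InvDer pre-Lie algebra, where $x\ast y=[Rx,y]$ for all $x,y\in L$.
   Context: $\mathbb{K}$ is a field of characteristic $0$. A derivation of an algebra $(L,\mu)$ is a linear map $d:L\to L$ with $d(\mu(x,y))=\mu(dx,y)+\mu(x,dy)$ for all $x,y$. $\mathrm{InvDer}(L)$ denotes the set of invertible derivations $\delta$ of the algebra $L$ such that $\delta^{-1}$ is also a derivation. A Rota-Baxter operator of weight $0$ on an algebra $(L,\mu)$ is a linear map $R:L\to L$ with $\mu(Rx,Ry)=R(\mu(Rx,y)+\mu(x,Ry))$ for all $x,y\in L$. An InvDer-Lie algebra $(L,[\cdot,\cdot],\delta)$ is a Lie algebra $(L,[\cdot,\cdot])$ equipped with $\delta\in\mathrm{InvDer}(L)$ satisfying $[\delta x,[y,z]]+[\delta y,[z,x]]+[\delta z,[x,y]]=0$ for all $x,y,z\in L$. A pre-Lie algebra is a vector space $L$ with a bilinear product $\ast$ such that $x\ast(y\ast z)-(x\ast y)\ast z=y\ast(x\ast z)-(y\ast x)\ast z$ for all $x,y,z\in L$. An InvDer pre-Lie algebra $(L,\ast,\delta)$ is a pre-Lie algebra $(L,\ast)$ equipped with $\delta\in\mathrm{InvDer}(L)$ satisfying $\delta x\ast(y\ast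 z)-(x\ast y)\ast\delta z=\delta y\ast(x\ast z)-(y\ast x)\ast\delta z$ for all $x,y,z\in L$. *)

(* Defs.v *)
From HB Require Import structures.
From mathcomp Require Import all_boot all_order all_algebra.

Set Implicit Arguments.
Unset Strict Implicit.
Unset Printing Implicit Defensive.

Import GRing.Theory.
Local Open Scope ring_scope.

(* An algebra (L, mu) is a vector space L, of arbitrary dimension, together   *)
(* with a bare binary operation mu; bilinearity is part of the predicates     *)
(* is_lie and is_prelie below.                                                *)

Definition is_bilinear (K : fieldType) (L : lmodType K) (mu : L -> L -> L) :=
  bilinear_for *:%R *:%R mu.

Definition is_derivation (K : fieldType) (L : lmodType K)
    (mu : L -> L -> L) (d : L -> L) : Prop :=
  linear d /\ forall x y, d (mu x y) = mu (d x) y + mu x (d y).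

Definition InvDer (K : fieldType) (L : lmodType K)
    (mu : L -> L -> L) (delta : L -> L) : Prop :=
  is_derivation mu delta /\
  exists deltaV : L -> L,
    [/\ cancel delta deltaV, cancel deltaV delta & is_derivation mu deltaV].

Definition is_rota_baxter0 (K : fieldType) (L : lmodType K)
    (mu : L -> L -> L) (R : L -> L) : Prop :=
  linear R /\ forall x y, mu (R x) (R y) = R (mu (R x) y + mu x (R y)).

Definition is_lie (K : fieldType) (L : lmodType K)
    (br : L -> L -> L) : Prop :=
  [/\ is_bilinear br,
      forall x, br x x = 0
    & forall x y z, br x (br y z) + br y (br z x) + br z (br x y) = 0].

Definition is_invder_lie (K : fieldType) (L : lmodType K)
    (br : L -> L -> L) (delta : L -> L) : Prop :=
  [/\ is_lie br,
      InvDer br delta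
    & forall x y z,
        br (delta x) (br y z) + br (delta y) (br z x) + br (delta z) (br x y)
        = 0].

Definition is_prelie (K : fieldType) (L : lmodType K)
    (m : L -> L -> L) : Prop :=
  is_bilinear m /\
  forall x y z, m x (m y z) - m (m x y) z = m y (m x z) - m (m y x) z.

Definition is_invder_prelie (K : fieldType) (L : lmodType K)
    (m : L -> L -> L) (delta : L -> L) : Prop :=
  [/\ is_prelie m,
      InvDer m delta
    & forall x y z,
        m (delta x) (m y z) - m (m x y) (delta z)
        = m (delta y) (m x z) - m (m y x) (delta z)].

(* Main.v *)
Require Import Defs.
From HB Require Import structures.
From mathcomp Require Import all_boot all_order all_algebra.

(** Write x * y = [R x, y]. Both pre-Lie identities are one computation, made
    for a map [f] commuting with [R]: [f = id] gives the pre-Lie identity and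
    [f = delta] its twisted form. Exchanging x and y in (x * y) * f z changes it
    by [R[R x, y] - R[R y, x], f z], and antisymmetry turns the Rota-Baxter
    identity into R[R x, y] - R[R y, x] = [R x, R y]. What is left to prove,
      [f (R x), [R y, z]] - [f (R y), [R x, z]] = [[R x, R y], f z],
    is, up to antisymmetry, the cyclic identity
      [f a, [b, c]] + [f b, [c, a]] + [f c, [a, b]] = 0
    at (a, b, c) = (R x, R y, z). The latter is the Jacobi identity for
    [f = id] and the compatibility condition of an InvDer-Lie algebra for
    [f = delta]. This is [twisted_prelie_rota_baxter].

    A derivation of the bracket that commutes with [R] is also a derivation of
    the product *, and the inverse of a map commuting with [R] commutes with
    [R]; so [delta] and its inverse both remain derivations
    ([InvDer_precomp]). *)

Set Implicit Arguments.
Unset Strict Implicit.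
Unset Printing Implicit Defensive.

Import GRing.Theory.
Local Open Scope ring_scope.

Section Bilinear.
Variables (K : fieldType) (L : lmodType K) (br : L -> L -> L).
Hypothesis brB : is_bilinear br.

Lemma bilinearDl x y z : br (x + y) z = br x z + br y z.
Proof. by have := brB.1 z 1 x y; rewrite /= !scale1r. Qed.

Lemma bilinearDr x y z : br x (y + z) = br x y + br x z.
Proof. by have := brB.2 x 1 y z; rewrite /= !scale1r. Qed.

Lemma bilinearNr x y : br x (- y) = - br x y.
Proof.
have br0 : br x 0 = 0 by apply: (addrI (br x 0)); rewrite -bilinearDr !addr0.
by apply/eqP; rewrite -addr_eq0 -bilinearDr addNr br0.
Qed.

Lemma alternating_anticomm :
  (forall x, br x x = 0) -> forall x y, br x y = - br y x.
Proof.
move=> alt x y; apply/eqP; rewrite -addr_eq0.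
by have := alt (x + y); rewrite bilinearDl !bilinearDr !alt add0r addr0 => ->.
Qed.

Lemma bilinear_precomp (R : L -> L) :
  linear R -> is_bilinear (fun x y => br (R x) y).
Proof.
move=> linR; split=> [y a u v | x a u v] /=; last exact: brB.2.
by rewrite linR; exact: brB.1.
Qed.

End Bilinear.

(** The general [f] treats the Jacobi identity and the compatibility of a
    derivation with the bracket together: it enters only through the cyclic
    identity, which is applied to two elements of the image of [R] and [z]. *)
Lemma twisted_prelie_rota_baxter (K : fieldType) (L : lmodType K)
    (br : L -> L -> L) (R f : L -> L) :
    is_bilinear br -> (forall x, br x x = 0) -> is_rota_baxter0 br R ->
    (forall x, f (R x) = R (f x)) ->
    (forall x y z,
      br (f x) (br y z) + br (f y) (br z x) + br (f z) (br x y) = 0) ->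
  forall x y z,
    br (R (f x)) (br (R y) z) - br (R (br (R x) y)) (f z)
    = br (R (f y)) (br (R x) z) - br (R (br (R y) x)) (f z).
Proof.
move=> brB alt [linR RB] fR jac x y z.
have anti := alternating_anticomm brB alt.
have RD u v : R (u + v) = R u + R v by have := linR 1 u v; rewrite !scale1r.
have Rsplit : R (br (R x) y) = br (R x) (R y) + R (br (R y) x).
  by rewrite RB -RD (anti x) addrNK.
have := jac (R x) (R y) z.
rewrite !fR (anti z (R x)) (bilinearNr brB) (anti (f z)) => /eqP.
rewrite subr_eq0 => /eqP jacR.
rewrite Rsplit (bilinearDl brB) -jacR opprD opprB addrA.
by rewrite [_ + (_ - _)]addrC addrNK.
Qed.

Lemma derivation_precomp (K : fieldType) (L : lmodType K)
    (br : L -> L -> L) (R d : L -> L) :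
    is_derivation br d -> (forall x, d (R x) = R (d x)) ->
  is_derivation (fun x y => br (R x) y) d.
Proof. by move=> [lind der] dR; split=> // x y; rewrite der dR. Qed.

Lemma InvDer_precomp (K : fieldType) (L : lmodType K)
    (br : L -> L -> L) (R d : L -> L) :
    InvDer br d -> (forall x, d (R x) = R (d x)) ->
  InvDer (fun x y => br (R x) y) d.
Proof.
move=> [der [e [dK eK der_e]]] dR; split; first exact: derivation_precomp.
exists e; split=> //; apply: derivation_precomp => // x.
by rewrite -{1}(eK x) -dR dK.
Qed.

Theorem proposition3p2 (K : fieldType) (charK : [pchar K] =i pred0)
    (L : lmodType K) (br : L -> L -> L) (delta deltaV R : L -> L)
    (hL : is_invder_lie br delta)
    (deltaK : cancel delta deltaV) (deltaVK : cancel deltaV delta)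
    (hR : is_rota_baxter0 br R)
    (hdR : delta \o R =1 R \o delta)
    (hdVR : deltaV \o R =1 R \o deltaV) :
  is_invder_prelie (fun x y : L => br (R x) y) delta.
Proof.
have [[brB alt jac] inv_delta jac_delta] := hL.
split; last exact: twisted_prelie_rota_baxter.
- split; first exact: (bilinear_precomp brB hR.1).
  exact: (twisted_prelie_rota_baxter (f := id)).
- exact: InvDer_precomp.
Qed.
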